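(* Let $b\ge 2$ be an integer and let $A_b$ be the set of integers $m$ with $0\le m<b-1$ such that $m^2\equiv b(b-1)/2 \pmod{b-1}$. If $n$ is an integer such that $n^2$ is a strict pandigital number in base $b$ or a strict penholodigital number in base $b$, then $n\equiv m \pmod{b-1}$ for some $m\in A_b$.
   Context: Numbers are written in base $b$ without leading zeros, with digits $0,1,\dots,b-1$. A positive integer $N$ is a strict pandigital number in base $b$ if its base-$b$ representation contains each of the $b$ digits $0,1,\dots,b-1$ exactly once. $N$ is a strict penholodigital number in base $b$ if its base-$b$ representation does not contain the digit $0$ and contains each of the $b-1$ nonzero digits $1,\dots,b-1$ exactly once. *)

(* Defs.v *)
From mathcomp Require Import all_boot all_order all_algebra.
Set Implicit Arguments. Unset Strict Implicit. Unset Printing Implicit Defensive.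
Import Order.TTheory GRing.Theory Num.Theory.
Local Open Scope ring_scope.

(* [s] lists the digits least significant first, so the leading digit is the
   last item; the default value [1] makes the empty list, which represents 0,
   admissible. *)
Definition base_repr (b N : int) (s : seq int) : Prop :=
  [/\ forall d : int, d \in s -> 0 <= d < b,
      last 1 s != 0
    & N = \sum_(i < size s) s`_i * b ^+ i].

Definition strict_pandigital (b N : int) : Prop :=
  0 < N /\
  exists2 s : seq int, base_repr b N s &
    forall d : int, 0 <= d < b -> count_mem d s = 1%N.

Definition strict_penholodigital (b N : int) : Prop :=
  0 < N /\
  exists2 s : seq int, base_repr b N s &
    0 \notin s /\ forall d : int, 1 <= d < b -> count_mem d s = 1%N.

Definition root_residues (b : int) : pred int :=
  [pred m : int | (0 <= m < b - 1) &&
     (m ^+ 2 == ((b * (b - 1)) %/ 2)%Z %[mod b - 1])%Z].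

(* Main.v *)
Require Import Defs.
From mathcomp Require Import all_boot all_order all_algebra.
From mathcomp Require Import zify.
Set Implicit Arguments. Unset Strict Implicit. Unset Printing Implicit Defensive.
Import Order.TTheory GRing.Theory Num.Theory.
Local Open Scope ring_scope.

(* Casting out (b - 1): b = 1 mod (b - 1), so a number is congruent to the sum
   of its digits, which here is 0 + 1 + ... + (b - 1) = b (b - 1) / 2. *)

(** Pandigital and penholodigital numbers have the same nonzero digits, each occurring once, and
    differ only in the digit 0, which adds nothing to the digit sum. Hence [n ^+ 2] has the same
    residue in both cases, and reducing [n] itself modulo [b - 1] gives the required [m]. *)

Lemma digit_sum_modz (b : int) (s : seq int) :
  (\sum_(i < size s) s`_i * b ^+ i = \sum_(d <- s) d %[mod b - 1])%Z.
Proof.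
apply/eqP; rewrite eqz_mod_dvd (big_nth 0) big_mkord -sumrB.
apply: rpred_sum => i _.
(* Each term contributes [s_i * (b ^+ i - 1)], and [b - 1] divides [b ^+ i - 1]. *)
by rewrite -{2}(mulr1 s`_i) -mulrBr dvdz_mull // subrX1 dvdz_mulr.
Qed.

(** The multiplicity of 0 is left free so that both kinds of numbers are covered: without its zeros,
    [s] is a permutation of 1, ..., b - 1. *)
Lemma sum_nonzero_digits (b : nat) (s : seq int) :
  (forall d : int, d \in s -> 0 <= d < b%:Z) ->
  (forall d : int, 1 <= d < b%:Z -> count_mem d s = 1%N) ->
  \sum_(d <- s) d = ('C(b, 2))%:Z.
Proof.
move=> s_digits s_once.
have sE : perm_eq [seq d <- s | d != 0] [seq k%:Z | k <- iota 1 b.-1].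
  apply: uniq_perm.
  - apply: count_mem_uniq => d; rewrite count_filter mem_filter.
    have [->|d_neq0] := eqVneq d 0.
      by rewrite (eq_count (a2 := pred0)) ?count_pred0 // => x /=; case: eqP.
    rewrite (eq_count (a2 := pred1 d)); last first.
      by move=> x /=; case: (eqVneq x d) => [->|].
    have [ds|/count_memPn->//] := boolP (d \in s).
    by rewrite s_once //; have := s_digits d ds; lia.
  - by rewrite map_inj_uniq ?iota_uniq // => i j [].
  move=> d; rewrite mem_filter; apply/andP/mapP => [[d_neq0 /s_digits d_lt]|].
    by exists `|d|%N; rewrite ?mem_iota; lia.
  move=> [k]; rewrite mem_iota => k_lt ->; split; first lia.
  by rewrite -has_pred1 has_count s_once //; lia.
rewrite (bigID (fun d => d != 0)) /= [X in _ + X]big1 ?addr0; last first.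
  by move=> d /negPn/eqP.
rewrite -big_filter (perm_big _ sE) big_map -bin2_sum.
(* [bin2_sum] sums from 0 and the permutation starts at 1; for positive [b] the extra term is 0. *)
case: b {s_digits s_once sE} => [|b] /=; first by rewrite big_nil big_geq.
by rewrite big_ltn // add0n /index_iota subSS subn0 (big_morph Posz PoszD (erefl 0)).
Qed.

Lemma bin2_divz (b : nat) : ('C(b, 2))%:Z = ((b%:Z * (b%:Z - 1)) %/ 2)%Z.
Proof.
case: b => [|b]; first by rewrite mul0r.
by rewrite bin2 -divn2 /= -addn1 PoszD addrK -PoszD -PoszM divz_nat.
Qed.

Theorem theorem1 (b : int) (hb : 2 <= b) (n : int)
    (hn : strict_pandigital b (n ^+ 2) \/ strict_penholodigital b (n ^+ 2)) :
  exists2 m : int, m \in root_residues b & (n = m %[mod b - 1])%Z.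
Proof.
have [s [s_digits _ n2E] s_once] : exists2 s, base_repr b (n ^+ 2) s &
    forall d : int, 1 <= d < b -> count_mem d s = 1%N.
  case: hn => [[_ [s sE s_once]]|[_ [s sE [_ s_once]]]]; exists s => // d d_lt.
  by apply: s_once; lia.
case: b hb hn s_digits n2E s_once => // b hb _ s_digits n2E s_once.
(* The bound [2 <= b] makes the modulus positive, so this remainder lies in the required range. *)
exists (n %% (b%:Z - 1))%Z; last by rewrite modz_mod.
rewrite inE modz_ge0 ?ltz_pmod /=; [|lia..].
by rewrite modzXm n2E digit_sum_modz (sum_nonzero_digits s_digits s_once) bin2_divz.
Qed.
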